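(* Let $d\ge 1$ be a fixed integer. Let $p$ be a prime, let $1\le U,V<p$ be integers, let ${\mathfrak C}\subseteq[1,U]\times[1,V]$ be a convex set, and let $\{\alpha_u\}_{u=1}^U$ be complex numbers with $|\alpha_u|\le 1$. For a polynomial $f\in{\mathbb F}_p[X]$ of degree $d$ define $$S_f({\mathcal A};{\mathfrak C})=\sum_{(u,v)\in{\mathfrak C}}\alpha_u\,{\mathbf e}_p\big(v/f(u)\big),$$ where the sum is over integer points $(u,v)\in{\mathfrak C}$ with $f(u)\not\equiv 0\pmod p$. Then, uniformly over all such $f$, $U$, $V$, ${\mathfrak C}$ and weights, $$|S_f({\mathcal A};{\mathfrak C})|\le p^{d/(d+1)+o(1)}U^{d/2}+V p^{o(1)}$$ as $p\to\infty$.
   Context: ${\mathbf e}_p(z)=\exp(2\pi i z/p)$, where $v/f(u)$ denotes the element $v\cdot f(u)^{-1}$ of ${\mathbb F}_p$, represented by an integer in $\{0,\dots,p-1\}$. A polynomial of degree $d$ means exact degree $d$ (leading coefficient nonzero in ${\mathbb F}_p$). The notation $p^{o(1)}$ denotes a factor $p^{\epsilon(p)}$ with $\epsilon(p)\to 0$ as $p\to\infty$, where $\epsilon$ may depend on $d$ only. *)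

(* Defs.v *)
From mathcomp Require Import all_boot all_order all_algebra.
From mathcomp Require Import complex.
From mathcomp Require Import all_classical all_reals all_analysis.

Set Implicit Arguments.
Unset Strict Implicit.
Unset Printing Implicit Defensive.

Import Order.TTheory GRing.Theory Num.Theory.
Import numFieldNormedType.Exports.

Local Open Scope classical_set_scope.
Local Open Scope complex_scope.
Local Open Scope ring_scope.

Definition e_mod (R : realType) (p : nat) (z : R) : R[i] :=
  cos (2 * pi * z / p%:R) +i* sin (2 * pi * z / p%:R).

(* For p prime, 'F_p is the field of residues 0, ..., p - 1, and the coercion
   'F_p >-> nat yields that representative. *)
Definition rat_residue (p : nat) (f : {poly 'F_p}) (u v : nat) : nat :=
  (v%:R / f.[u%:R] : 'F_p).

(* C is meant to be contained in [1, U] x [1, V], so the double sum runs over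
   all the integer points (u, v) of C with f(u) != 0 in 'F_p. *)
Definition S_sum (R : realType) (p : nat) (f : {poly 'F_p}) (U V : nat)
    (alpha : nat -> R[i]) (C : set (R^o * R^o)) : R[i] :=
  \sum_(1 <= u < U.+1)
    \sum_(1 <= v < V.+1 | `[< C (u%:R, v%:R) >] && (f.[u%:R] != 0))
      alpha u * e_mod p (rat_residue f u v)%:R.

(* Main.v *)
Require Import Defs.
From mathcomp Require Import all_boot all_order all_algebra.
From mathcomp Require Import complex.
From mathcomp Require Import all_classical all_reals all_analysis.
From mathcomp Require Import zify ring lra.

Set Implicit Arguments.
Unset Strict Implicit.
Unset Printing Implicit Defensive.

Import Order.TTheory GRing.Theory Num.Theory.
Import numFieldNormedType.Exports.

Local Open Scope classical_set_scope.
Local Open Scope complex_scope.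
Local Open Scope ring_scope.

(** For fixed [u], the integers [v] with [(u, v)] in [C] form an interval, so the
    inner sum is a geometric progression of ratio [e_p(1 / f(u))] and is
    [O(min(V, p / |z|))], where [z] is the residue of [1 / f(u)] of least
    absolute value. It remains to count the [u <= U] with [|z| <= Z].

    Let [H] be maximal with [H^(d+1) U^(0 + 1 + ... + d) < p]. By the pigeonhole
    principle some [t <> 0] makes all the coefficients of [t f] congruent to
    integers [b_i] with [|b_i| <= p / (H U^i)]. For [F = sum_i b_i X^i] the
    congruence [z f(u) = 1] gives [z F(u) = t + k p] in the integers, with only
    [O(1 + Z / H)] possible values of [k]. Since [t + k p] is nonzero, the divisor
    bound leaves [p^o(1)] values of [z] for each [k], and each [z] comes from at
    most [d] values of [u]. Summing dyadically over [Z] gives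
    [p^o(1) (V + p / H)], and [p / H] is at most [2 p^(d/(d+1)) U^(d/2)]. *)

(** * The divisor bound *)

(** With [q] the quotient of [e + 1] by [k], one has [e + 1 <= k (q + 1) <= k 2^q] and
    [q k <= e + 1]. Hence the constant [2 k^k], whose factor 2 absorbs the shift from [e + 1] to
    [e]. *)
Lemma expnS_le_exp2 k : (0 < k)%N ->
  exists2 c, (0 < c)%N & forall e, (e.+1 ^ k <= c * 2 ^ e)%N.
Proof.
move=> k_gt0; exists (2 * k ^ k)%N; first by rewrite muln_gt0 expn_gt0 k_gt0.
move=> e; set q := (e.+1 %/ k)%N.
have le_e : (e.+1 <= k * 2 ^ q)%N.
  apply: leq_trans (ltnW (ltn_ceil e.+1 k_gt0)) _.
  by rewrite mulnC leq_mul2l ltn_expl// orbT.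
apply: leq_trans (_ : (k * 2 ^ q) ^ k <= _)%N; first by rewrite leq_exp2r.
rewrite expnMn -expnM mulnAC -expnS mulnC leq_mul2r leq_exp2l//.
by rewrite leq_trunc_div orbT.
Qed.

(** Every divisor [d] of [m n] is the product of [gcd(d, m)], which divides [m], and
    [d / gcd(d, m)], which divides [n]. *)
Lemma size_divisorsM m n : (0 < m)%N -> (0 < n)%N ->
  (size (divisors (m * n)) <= size (divisors m) * size (divisors n))%N.
Proof.
move=> m_gt0 n_gt0; rewrite -(size_allpairs muln).
apply: uniq_leq_size; first exact: divisors_uniq.
move=> d; rewrite -dvdn_divisors ?muln_gt0 ?m_gt0// => d_mn.
have g_gt0 : (0 < gcdn d m)%N by rewrite gcdn_gt0 m_gt0 orbT.
apply/allpairsP; exists (gcdn d m, d %/ gcdn d m)%N; split => /=.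
- by rewrite -dvdn_divisors// dvdn_gcdr.
- rewrite -dvdn_divisors// -(dvdn_pmul2r g_gt0) divnK ?dvdn_gcdl//.
  by rewrite mulnC muln_gcdl dvdn_gcd dvdn_mulr.
- by rewrite mulnC divnK ?dvdn_gcdl.
Qed.

Lemma size_divisors_pfactor q e : prime q -> size (divisors (q ^ e)) = e.+1.
Proof.
move=> q_pr; rewrite -[RHS](size_iota 0) -[RHS](size_map (expn q)).
apply/perm_size/uniq_perm; first exact: divisors_uniq.
  by rewrite map_inj_uniq ?iota_uniq// => i j /eqP; rewrite eqn_exp2l ?prime_gt1// => /eqP.
move=> d; rewrite -dvdn_divisors ?expn_gt0 ?prime_gt0//.
apply/dvdn_pfactor/mapP => //; case=> i.
- by move=> ie ->; exists i; rewrite // mem_iota.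
- by rewrite mem_iota => ie ->; exists i.
Qed.

(** This is [tau(n) = O(n^(1/k))] with the root cleared. A prime power [q^e] contributes
    [(e + 1)^k], which is at most [2^(e k) <= q^e] once [q >= 2^k]; only the smaller primes cost a
    constant factor. *)
Lemma divisor_bound k : (0 < k)%N ->
  exists2 c, (0 < c)%N &
    forall n, (0 < n)%N -> (size (divisors n) ^ k <= c * n)%N.
Proof.
move=> k_gt0; have [c c_gt0 c_bnd] := expnS_le_exp2 k_gt0.
exists (c ^ (2 ^ k))%N; first by rewrite expn_gt0 c_gt0.
(* Induction on a strict bound [B] for the prime factors of [n], removing the whole power of one
   prime at a time. The exponent [minn B (2 ^ k)] bounds the number of primes that cost a factor
   [c]. *)
suff smooth B n : (0 < n)%N -> (forall q, prime q -> q %| n -> q < B)%N ->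
    (size (divisors n) ^ k <= c ^ minn B (2 ^ k) * n)%N.
  move=> n n_gt0; apply: leq_trans (smooth n.+1 n n_gt0 _) _.
    by move=> q _ /dvdn_leq -/(_ n_gt0).
  by rewrite leq_mul2r leq_pexp2l ?geq_minr ?orbT.
elim: B n => [|B IH] n n_gt0 n_smooth.
  have [n_le1|/pdiv_prime n_pr] := leqP n 1.
    have -> : n = 1%N by apply/eqP; rewrite eqn_leq n_le1.
    by rewrite min0n /= exp1n.
  by have := n_smooth _ n_pr (pdiv_dvd n).
have le_c : (c ^ minn B (2 ^ k) <= c ^ minn B.+1 (2 ^ k))%N.
  by rewrite leq_pexp2l// leq_min geq_minr andbT geq_min leqnSn.
have [B_pr|B_npr] := boolP (prime B); last first.
  apply: leq_trans (leq_mul le_c (leqnn n)); apply: IH => // q q_pr q_n.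
  have := n_smooth q q_pr q_n; rewrite ltnS leq_eqVlt => /orP[/eqP qB|//].
  by rewrite -qB q_pr in B_npr.
have [m co_m def_n] := pfactor_coprime B_pr n_gt0.
set e := logn B n in def_n.
have m_gt0 : (0 < m)%N by move: n_gt0; rewrite def_n muln_gt0 => /andP[].
have IHm : (size (divisors m) ^ k <= c ^ minn B (2 ^ k) * m)%N.
  apply: IH => // q q_pr q_m; have : (q < B.+1)%N.
    by apply: n_smooth => //; rewrite def_n dvdn_mulr.
  rewrite ltnS leq_eqVlt => /orP[/eqP qB|//].
  by move: co_m; rewrite prime_coprime// -qB q_m.
have Be_gt0 : (0 < B ^ e)%N by rewrite expn_gt0 prime_gt0.
have le_n : (size (divisors n) ^ k <= size (divisors m) ^ k * e.+1 ^ k)%N.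
  rewrite -expnMn leq_exp2r// def_n -(size_divisors_pfactor e B_pr).
  exact: size_divisorsM.
apply: leq_trans le_n _.
apply: leq_trans (leq_mul IHm (leqnn _)) _.
rewrite [in leqRHS]def_n mulnAC [leqRHS]mulnA [leqRHS]mulnAC leq_mul2r; apply/orP; right.
have [B_small|B_big] := boolP (B < 2 ^ k)%N.
  rewrite (minn_idPl (ltnW B_small)) (minn_idPl B_small) expnSr -mulnA.
  rewrite leq_mul2l (leq_trans (c_bnd e)) ?orbT// leq_mul2l.
  have [->|e_gt0] := posnP e; first by rewrite orbT.
  by rewrite leq_exp2r// prime_gt1 ?orbT.
apply: leq_mul => //; apply: leq_trans (_ : (2 ^ e) ^ k <= _)%N.
  by rewrite leq_exp2r// ltn_expl.
rewrite -expnM mulnC expnM; have [->//|e_gt0] := posnP e.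
by rewrite leq_exp2r// leqNgt.
Qed.

(** * Pigeonhole and small multiples modulo [p] *)

Lemma card_Fp_pigeonhole p d (m : nat -> nat) (g : nat -> 'F_p -> 'F_p) :
  prime p -> (forall i, 0 < m i)%N -> (\prod_(i < d) m i < p)%N ->
  exists x y, x != y /\ forall i, (i < d)%N ->
    ((m i * g i x) %/ p = (m i * g i y) %/ p)%N.
Proof.
move=> p_pr m_gt0 lt_mp; have p_gt0 := prime_gt0 p_pr.
have cell_lt (i : 'I_d) (x : 'F_p) : ((m i * g i x) %/ p < m i)%N.
  rewrite ltn_divLR// ltn_pmul2l//.
  by rewrite -[ltnRHS](Fp_cast p_pr); exact: ltn_ord.
pose phi (x : 'F_p) : {dffun forall i : 'I_d, 'I_(m i)} :=
  [ffun i => Ordinal (cell_lt i x)].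
have /injectivePn[x [y xy eq_phi]] : ~~ injectiveb phi.
  apply: contraL lt_mp => /injectiveP/leq_card.
  rewrite card_Fp// card_dep_ffun foldrE big_map big_enum/= -leqNgt.
  by under eq_bigr do rewrite card_ord.
exists x, y; split => // i i_d.
by have /ffunP/(_ (Ordinal i_d)) := eq_phi; rewrite !ffunE => -[].
Qed.

Lemma same_cell_dist p m x y : (0 < p)%N ->
  ((m * x) %/ p = (m * y) %/ p)%N -> (m * `|x%:Z - y%:Z| <= p)%N.
Proof.
move=> p_gt0; have := divn_eq (m * x) p; have := divn_eq (m * y) p.
have := ltn_pmod (m * x) p_gt0; have := ltn_pmod (m * y) p_gt0.
move: (_ %/ p)%N (_ %% p)%N => a b; move: (_ %/ p)%N (_ %% p)%N => a' b'.
move=> hb hb' h h' e; subst a'.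
by have [xy|xy] := leqP x y; nia.
Qed.

(** Cut the range of the [i]-th coordinate [x f_i] into [H U^i] cells. There are fewer than [p]
    boxes, so two multipliers [x] and [y] share one, and [t = x - y] works. Here [d] is the number
    of coefficients, not the degree. *)
Lemma small_multiple p d H U (f : {poly 'F_p}) :
  prime p -> (0 < H)%N -> (0 < U)%N ->
  (H ^ d * U ^ (\sum_(i < d) i) < p)%N ->
  exists (t : 'F_p) (b : nat -> int), t != 0 /\ forall i, (i < d)%N ->
    (b i)%:~R = t * f`_i /\ (`|b i| * (H * U ^ i) <= p)%N.
Proof.
move=> p_pr H_gt0 U_gt0 lt_p; have p_gt0 := prime_gt0 p_pr.
have [||x [y [xy eq_cell]]] :=
    @card_Fp_pigeonhole p d (fun i => H * U ^ i)%N (fun i x => x * f`_i) p_pr.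
- by move=> i; rewrite muln_gt0 H_gt0 expn_gt0 U_gt0.
- by rewrite big_split/= prod_nat_const card_ord -expn_sum.
exists (x - y), (fun i => Posz (x * f`_i)%R - Posz (y * f`_i)%R).
split; first by rewrite subr_eq0.
move=> i i_d; split; last first.
  by rewrite mulnC; apply: same_cell_dist p_gt0 (eq_cell i i_d).
by rewrite intrB -!pmulrn (natr_Zp (x * _)) (natr_Zp (y * _)) mulrBl.
Qed.

(** * Union bound and fibres of a polynomial *)

Lemma count_le_cover (T I : eqType) (s : seq T) (P : pred T) (r : seq I)
    (Q : I -> pred T) B :
  (forall x, x \in s -> P x -> has (Q^~ x) r) ->
  (forall i, i \in r -> (count (Q i) s <= B)%N) ->
  (count P s <= size r * B)%N.
Proof.
elim: r P => [|i r IH] P cov bnd /=.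
  rewrite mul0n leqn0; apply/eqP; rewrite -(count_pred0 s).
  by apply: eq_in_count => x xs; apply/negbTE/negP => /(cov x xs).
apply: leq_trans (_ : count (Q i) s + count [pred x | P x && ~~ Q i x] s <= _)%N.
  rewrite -count_predUI; apply: leq_trans (leq_addr _ _).
  by apply: sub_count => x /= ->; rewrite orbN.
rewrite mulSn leq_add ?bnd ?mem_head//.
apply: IH => [x xs /andP[Px /negbTE Qx]|j jr].
  by have := cov x xs Px; rewrite /= Qx.
by rewrite bnd// inE jr orbT.
Qed.

Lemma Fp_natr_inj p a b : prime p -> (a < p)%N -> (b < p)%N ->
  a%:R = b%:R :> 'F_p -> a = b.
Proof.
by move=> p_pr ap bp /(congr1 val); rewrite /= !val_Fp_nat// !modn_small.
Qed.

(** The nonzero polynomial [f - x] has at most [d] roots, and [U < p] keeps the residues of the [u]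
    distinct. *)
Lemma count_poly_fiber p d U (f : {poly 'F_p}) x :
  prime p -> (0 < d)%N -> (U < p)%N -> size f = d.+1 ->
  (count (fun u => f.[u%:R] == x) (index_iota 1 U.+1) <= d)%N.
Proof.
move=> p_pr d_gt0 Up size_f; set s := index_iota _ _.
have size_fx : size (f - x%:P) = d.+1.
  rewrite size_polyDl// size_polyN size_f (leq_ltn_trans (size_polyC_leq1 x))//.
have fx_neq0 : f - x%:P != 0 by rewrite -size_poly_gt0 size_fx.
rewrite -ltnS -size_fx -size_filter -(size_map (fun u : nat => u%:R : 'F_p)).
apply: max_poly_roots => //.
  apply/allP => y /mapP[u]; rewrite mem_filter => /andP[/eqP fu _] ->.
  by rewrite /root hornerD hornerN hornerC fu subrr.
rewrite map_inj_in_uniq ?filter_uniq ?iota_uniq// => a b.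
rewrite !mem_filter !mem_index_iota => /and3P[_ _ aU] /and3P[_ _ bU].
by apply: Fp_natr_inj => //; lia.
Qed.

(** * Least absolute residues and small inverses of [f(u)] *)

(** This is [p] times the distance from [x / p] to the nearest integer. *)
Definition fp_abs p (x : 'F_p) : nat := minn x (p - x).

Lemma fp_absP p (x : 'F_p) : prime p ->
  exists s : bool, ((-1) ^+ s * (fp_abs x)%:Z)%:~R = x.
Proof.
move=> p_pr; have xp : (x < p)%N by rewrite -[ltnRHS](Fp_cast p_pr) ltn_ord.
rewrite /fp_abs; have [_|_] := leqP x (p - x)%N.
  by exists false; rewrite expr0 mul1r -pmulrn natr_Zp.
exists true; rewrite expr1 mulN1r intrN -pmulrn natrB; last exact: ltnW.
by rewrite (pchar_Fp_0 p_pr) (natr_Zp x) sub0r opprK.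
Qed.

Lemma fp_abs_gt0 p (x : 'F_p) : prime p -> x != 0 -> (0 < fp_abs x)%N.
Proof.
move=> p_pr x_neq0; have xp : (x < p)%N by rewrite -[ltnRHS](Fp_cast p_pr) ltn_ord.
by rewrite leq_min subn_gt0 xp lt0n andbT.
Qed.

Lemma fp_abs_le p (x : 'F_p) : prime p -> (2 * fp_abs x <= p)%N.
Proof. by rewrite /fp_abs; lia. Qed.

Lemma Fp_intr_eq0 p (n : int) : prime p -> (n%:~R == 0 :> 'F_p) = (p %| n)%Z.
Proof.
move=> p_pr; rewrite /dvdz; case: n => n /=.
  by rewrite -(dvdn_pcharf (pchar_Fp p_pr)).
by rewrite NegzE rmorphN/= oppr_eq0 -(dvdn_pcharf (pchar_Fp p_pr)).
Qed.

(** The witness is [z F(u)], with [z] the signed least residue of [1 / f(u)]: modulo [p] it is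
    [t f(u) / f(u) = t]. Each of the [d + 1] terms of [F(u)] is at most [p / H] in absolute
    value. *)
Lemma small_inverse_witness p d H U Z (f : {poly 'F_p}) t (b : nat -> int) u :
  prime p -> size f = d.+1 -> (u <= U)%N ->
  (forall i, (i < d.+1)%N ->
    (b i)%:~R = t * f`_i /\ (`|b i| * (H * U ^ i) <= p)%N) ->
  f.[u%:R] != 0 -> (fp_abs (f.[u%:R])^-1 <= Z)%N ->
  exists n : int, [/\ n%:~R = t, (fp_abs (f.[u%:R])^-1 %| `|n|)%N &
                      (`|n| * H <= d.+1 * p * Z)%N].
Proof.
move=> p_pr size_f uU b_small fu_neq0 z_le.
have [s def_z] := fp_absP (f.[u%:R])^-1 p_pr.
set z := (_ * _)%R in def_z; pose F := \sum_(i < d.+1) b i * u%:Z ^+ i.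
have F_mod : F%:~R = t * f.[u%:R].
  rewrite rmorph_sum horner_coef size_f mulr_sumr; apply: eq_bigr => i _.
  rewrite rmorphM rmorphXn/= (b_small i (ltn_ord i)).1.
  by rewrite mulrA pmulrn.
have F_bnd : (`|F| * H <= d.+1 * p)%N.
  rewrite -lez_nat !PoszM abszE; apply: le_trans (_ : \sum_(i < d.+1) p%:Z <= _).
    apply: le_trans (ler_wpM2r _ (ler_norm_sum _ _ _)) _ => //.
    rewrite mulr_suml; apply: ler_sum => i _; rewrite normrM.
    apply: le_trans (_ : `|b i| * (H * U ^ i)%N <= _); last first.
      by rewrite -abszE -PoszM lez_nat; apply: (b_small i (ltn_ord i)).2.
    rewrite -mulrA ler_wpM2l// mulrC PoszM ler_wpM2l//.
    by rewrite ger0_norm ?exprn_ge0// -!natz natrX lerXn2r ?nnegrE ?ler0n// ler_nat.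
  by rewrite sumr_const card_ord -mulr_natl natz.
exists (z * F); split.
- by rewrite rmorphM/= def_z F_mod mulrCA mulVf// mulr1.
- by rewrite abszM /z abszM absz_sign mul1n dvdn_mulr.
rewrite abszM /z abszM absz_sign mul1n -mulnA mulnC.
by apply: leq_mul.
Qed.

(** The bound multiplies [2 K + 1] values of [k], at most [T] divisors of each [t + k p], two signs,
    and at most [d] values of [u] for each signed residue. *)
Lemma count_small_inverse p d H U Z T (f : {poly 'F_p}) :
  prime p -> (0 < d)%N -> (0 < H)%N -> (0 < U < p)%N -> size f = d.+1 ->
  (H ^ d.+1 * U ^ (\sum_(i < d.+1) i) < p)%N -> (Z <= 2 * p)%N ->
  (forall n, 0 < n -> n <= (2 * d + 3) * p ^ 2 -> size (divisors n) <= T)%N ->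
  (count (fun u => (f.[u%:R] != 0%R) && (fp_abs (f.[u%:R])^-1 <= Z))
     (index_iota 1 U.+1) * H <= 2 * d * T * (3 * H + 2 * d.+1 * Z))%N.
Proof.
move=> p_pr d_gt0 H_gt0 /andP[U_gt0 Up] size_f H_small Zp T_bnd.
have p_gt1 := prime_gt1 p_pr.
have [t [b [t_neq0 b_small]]] := small_multiple f p_pr H_gt0 U_gt0 H_small.
have [K K_ge K_lt] : exists2 K, (K * H <= d.+1 * Z + H)%N & (d.+1 * Z < K * H)%N.
  exists (d.+1 * Z %/ H).+1; last exact: ltn_ceil.
  by rewrite mulSn addnC leq_add2r leq_trunc_div.
pose n_ j := (t : nat)%:Z + (j%:Z - K%:Z) * p%:Z.
have tp : (t < p)%N by rewrite -[ltnRHS](Fp_cast p_pr) ltn_ord.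
have t_gt0 : (0 < t)%N by rewrite lt0n.
pose E (m : nat) (s : bool) (u : nat) :=
  f.[u%:R] == (((-1) ^+ s * m%:Z)%:~R)^-1.
pose Q1 (m u : nat) := has ((E m)^~ u) [:: false; true].
pose Q (j u : nat) := has (Q1^~ u) (divisors `|n_ j|%N).
apply: leq_trans (_ : (2 * K).+1 * (T * (2 * d)) * H <= _)%N; last first.
  have K_le : ((2 * K).+1 * H <= 3 * H + 2 * d.+1 * Z)%N.
    by move: K_ge; clear; lia.
  by rewrite mulnAC mulnC [(T * _)%N]mulnC; apply: leq_mul.
rewrite leq_mul2r; apply/orP; right.
rewrite -[(2 * K).+1](size_iota 0); apply: (@count_le_cover _ _ _ _ _ Q).
- move=> u; rewrite mem_index_iota => /andP[u_gt0 uU] /andP[fu_neq0 z_le].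
  have [n [n_mod z_dvd n_bnd]] :=
    small_inverse_witness p_pr size_f (ltnSE uU) b_small fu_neq0 z_le.
  have /dvdzP[k def_n] : (p %| n - (t : nat)%:Z)%Z.
    by rewrite -Fp_intr_eq0// intrB n_mod -pmulrn natr_Zp subrr.
  (* Multiplying [|k| p <= |n| + t] by [H] gives [|k| p H < (K + 1) H p], since
     [|n| H <= (d + 1) p Z < K H p] and [t < p]. *)
  have k_bnd : (`|k| <= K)%N.
    have kp : (`|k| * p <= `|n| + t)%N.
      have := congr1 absz def_n; rewrite abszM/=; clear -t; lia.
    have : (`|k| * p * H < K.+1 * H * p)%N.
      by move: kp n_bnd K_lt tp H_gt0; clear; nia.
    by rewrite mulnAC !ltn_pmul2r// ltnW.
  apply/hasP; exists (absz (k + K%:Z)); first by rewrite mem_iota/=; lia.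
  have def_nj : n_ (absz (k + K%:Z)) = n.
    by rewrite /n_ (_ : ((absz (k + K%:Z))%:Z = k + K%:Z)%R); [lia|lia].
  apply/hasP; exists (fp_abs (f.[u%:R])^-1).
    rewrite -dvdn_divisors def_nj// absz_gt0; apply/eqP => n0.
    by move: n_mod; rewrite n0/= => t0; rewrite -t0 eqxx in t_neq0.
  have [s def_z] := fp_absP (f.[u%:R])^-1 p_pr.
  apply/hasP; exists s; first by case: s {def_z}.
  by rewrite /E def_z invrK.
move=> j; rewrite mem_iota => /andP[_ j_le].
apply: leq_trans (_ : size (divisors `|n_ j|) * (2 * d) <= _)%N; last first.
  rewrite leq_mul2r; apply/orP; right; apply: T_bnd.
    (* As [0 < t < p], no [t + k p] vanishes, so its divisors can be counted. *)
    rewrite absz_gt0 /n_; apply/eqP; have [jK|jK] := leqP K j; move: jK t_gt0 tp; clear; nia.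
  have nj_le : (`|n_ j| <= t + K * p)%N.
    have jK : (`|j%:Z - K%:Z| <= K)%N by lia.
    have := leq_mul jK (leqnn p).
    rewrite -[X in (_ * X <= _)%N]/(`|p%:Z|%N) -abszM /n_.
    by move: (_ * _)%R (K * p)%N => x y; clear; lia.
  (* From [Z <= 2 p]. Then [t + K p < 2 (d + 1) p^2 + 2 p <= (2 d + 3) p^2], the range in which [T]
     bounds the number of divisors. *)
  have K_le : (K <= 2 * d.+1 * p + 1)%N by move: K_ge Zp H_gt0; clear; nia.
  by apply: leq_trans nj_le _; rewrite expnS expn1; move: K_le tp p_gt1; clear; nia.
apply: (@count_le_cover _ _ _ _ _ Q1) => [u _ //|m _].
apply: (@count_le_cover _ _ _ _ [:: false; true] (E m)) => [u _ //|s _].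
exact: count_poly_fiber.
Qed.

(** * Dyadic summation *)

(** If [2^j <= rho u < 2^(j+1)] then [x u <= min(V, q / 2^j)]. In each range the part [A] of the
    count is paired with [V], and [B 2^j] with [q / 2^j]. *)
Lemma sum_le_dyadic (R : realFieldType) (I : eqType) (s : seq I) (P : pred I)
    (x : I -> R) (rho : I -> nat) (V q A B : R) (L : nat) :
  0 <= V -> 0 <= q -> 0 <= A -> 0 <= B ->
  (forall u, u \in s -> P u -> [/\ x u <= V, x u * (rho u)%:R <= q &
                                   (0 < rho u < 2 ^ L)%N]) ->
  (forall j, (j < L)%N ->
    (count (fun u => P u && (rho u <= 2 ^ j.+1)%N) s)%:R <= A + B * 2 ^+ j) ->
  \sum_(u <- s | P u) x u <= L%:R * (A * V + B * q).
Proof.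
move=> V_ge0 q_ge0 A_ge0 B_ge0 x_bnd cnt.
pose m j : R := Num.min V (q / 2 ^+ j).
have m_ge0 j : 0 <= m j by rewrite le_min V_ge0 divr_ge0 ?exprn_ge0.
(* The ranges [rho u <= 2^(j+1)] are cumulative; the term with [j] the binary logarithm of [rho u]
   suffices, the others being nonnegative. *)
have le_x u : u \in s -> P u ->
    x u <= \sum_(j < L) if (rho u <= 2 ^ j.+1)%N then m j else 0.
  move=> us Pu; have [xV xq /andP[rho_gt0 rho_lt]] := x_bnd u us Pu.
  have /andP[j_le j_lt] := trunc_log_bounds (isT : 1 < 2)%N rho_gt0.
  set j := trunc_log 2 _ in j_le j_lt.
  have jL : (j < L)%N by rewrite -(@ltn_exp2l 2)// (leq_ltn_trans j_le).
  rewrite (bigD1 (Ordinal jL))//= (ltnW j_lt).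
  apply: le_trans (_ : m j <= _); last first.
    by rewrite lerDl sumr_ge0// => i _; case: ifP.
  rewrite le_min xV ler_pdivlMr ?exprn_gt0//=.
  have [x_ge0|x_lt0] := leP 0 (x u).
    apply: le_trans xq; rewrite ler_wpM2l// -natrX ler_nat//.
  by apply: le_trans q_ge0; rewrite pmulr_lle0 ?exprn_gt0// ltW.
have le_sum : \sum_(u <- s | P u) x u <=
    \sum_(u <- s | P u) \sum_(j < L) if (rho u <= 2 ^ j.+1)%N then m j else 0.
  rewrite [leLHS]big_seq_cond [leRHS]big_seq_cond; apply: ler_sum.
  by move=> u /andP[]; exact: le_x.
apply: le_trans le_sum _; rewrite exchange_big/=.
rewrite -[L in leRHS]card_ord mulr_natl -sumr_const; apply: ler_sum => j _.
rewrite -big_mkcondr/= big_const_seq iter_addr_0 -mulr_natl.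
apply: le_trans (ler_wpM2r (m_ge0 j) (cnt j (ltn_ord j))) _.
rewrite mulrDl lerD ?ler_wpM2l ?ge_min ?lexx//.
rewrite -mulrA ler_wpM2l// mulrC -ler_pdivlMr ?exprn_gt0//.
by rewrite ge_min lexx orbT.
Qed.

(** * Additive characters and geometric sums *)

Section ExponentialSums.
Variable R : realType.
Implicit Types (p : nat) (x y : R) (w : R[i]).

Lemma e_modD p x y : e_mod p (x + y) = e_mod p x * e_mod p y.
Proof.
rewrite /e_mod; have -> : 2 * pi * (x + y) / p%:R
   = 2 * pi * x / p%:R + 2 * pi * y / p%:R by rewrite mulrDr mulrDl.
by rewrite cosD sinD; apply/eqP; rewrite eq_complex/= eqxx addrC eqxx.
Qed.

Lemma e_mod0 p : e_mod p 0 = 1 :> R[i].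
Proof. by rewrite /e_mod mulr0 mul0r cos0 sin0. Qed.

Lemma e_mod_natM p n x : e_mod p (n%:R * x) = e_mod p x ^+ n.
Proof.
elim: n => [|n IH]; first by rewrite mul0r e_mod0.
by rewrite -natr1 mulrDl mul1r e_modD IH exprSr.
Qed.

Lemma e_mod_period p : (0 < p)%N -> e_mod p p%:R = 1 :> R[i].
Proof.
move=> p_gt0; rewrite /e_mod mulfK ?pnatr_eq0 -?lt0n//.
by rewrite mulr_natl cos2pi sin2pi.
Qed.

Lemma e_mod_modn p n : (0 < p)%N -> e_mod p (n %% p)%:R = e_mod p n%:R :> R[i].
Proof.
move=> p_gt0; rewrite [in RHS](divn_eq n p) natrD natrM e_modD.
by rewrite e_mod_natM e_mod_period// expr1n mul1r.
Qed.

Lemma norm_e_mod p x : `|e_mod p x| = 1.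
Proof. by rewrite normc_def/= cos2Dsin2 sqrtr1. Qed.

Lemma sqr_cos_sin_pi4 : (cos (pi / 4) ^+ 2 = 2^-1 :> R) /\ (sin (pi / 4) ^+ 2 = 2^-1 :> R).
Proof.
have c2 : cos (pi / 4) ^+ 2 = 2^-1 :> R.
  have := cos_mulr2n (pi / 4 : R).
  have -> : (pi / 4 : R) *+ 2 = pi / 2 by rewrite -mulr_natr; field.
  by rewrite cos_pihalf => h; lra.
by split => //; rewrite sin2cos2 c2; lra.
Qed.

(** A weak form of Jordan's inequality. Up to [pi / 4] the mean value theorem applies, with
    [cos >= 1/2 >= 1/pi]; beyond, [sin x >= 1/2 >= x / pi] by monotonicity. *)
Lemma sin_ge_linear x : 0 <= x <= pi / 2 -> x / pi <= sin x.
Proof.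
have pi2 := pi_ge2 R; have [c2 s2] := sqr_cos_sin_pi4.
move=> /andP[x_ge0 x_le]; rewrite ler_pdivrMr ?pi_gt0//.
have c_ge : 2^-1 <= cos (pi / 4) :> R.
  have : 0 <= cos (pi / 4) :> R by apply: cos_ge0_pihalf; apply/andP; split; lra.
  by move: c2; rewrite expr2; nra.
have s_ge : 2^-1 <= sin (pi / 4) :> R.
  have : 0 <= sin (pi / 4) :> R by apply: sin_ge0_pi; apply/andP; split; lra.
  by move: s2; rewrite expr2; nra.
have [x_small|x_big] := leP x (pi / 4).
  have [c] := @MVT_segment R sin cos 0 x x_ge0 (fun y _ => is_derive_sin y)
    (continuous_subspaceT (@continuous_sin R)).
  rewrite sin0 !subr0 in_itv/= => /andP[c_ge0 c_le] ->.
  have : cos (pi / 4) <= cos c.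
    have [->//|c_neq] := eqVneq c (pi / 4); apply: ltW; rewrite ltr_cos ?in_itv/=.
    - by rewrite lt_neqAle c_neq (le_trans c_le).
    - by apply/andP; split; lra.
    - by apply/andP; split; lra.
  move=> c_le'; rewrite mulrAC ler_peMl//.
  by nra.
have : sin (pi / 4) < sin x.
  by rewrite ltr_sin// in_itv/=; apply/andP; split; lra.
by nra.
Qed.

Lemma norm_1Be_mod p x :
  `|1 - e_mod p x| = (2 * `|sin (pi * x / p%:R)|)%:C.
Proof.
rewrite normc_def /e_mod/=.
have -> : 2 * pi * x / p%:R = (pi * x / p%:R) *+ 2 by rewrite -[RHS]mulr_natl !mulrA.
move: (pi * x / p%:R) => y.
rewrite cos_mulr2n sin_mulr2n; congr (_%:C).
rewrite -[RHS]ger0_norm ?mulr_ge0// -sqrtr_sqr; congr Num.sqrt.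
rewrite exprMn real_normK ?num_real//.
have := cos2Dsin2 y; move: (cos y) (sin y) => c s h.
have -> : s ^+ 2 = 1 - c ^+ 2 by lra.
have -> : (0 - (c * s) *+ 2) ^+ 2 = 4 * c ^+ 2 * s ^+ 2 by ring.
have -> : s ^+ 2 = 1 - c ^+ 2 by lra.
by ring.
Qed.

Lemma norm_1Be_mod_ge p (r : 'F_p) : prime p ->
  (2 * (fp_abs r)%:R / p%:R)%:C <= `|1 - e_mod p (r : nat)%:R : R[i]|.
Proof.
move=> p_pr; have p_gt0 : 0 < p%:R :> R by rewrite ltr0n prime_gt0.
have rp : (r < p)%N by rewrite -[ltnRHS](Fp_cast p_pr) ltn_ord.
rewrite norm_1Be_mod lecR -mulrA ler_wpM2l//.
(* The symmetry [sin (pi - y) = sin y] replaces [r] by its least absolute residue, which brings the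
   angle into [[0, pi / 2]]. *)
have -> : sin (pi * (r : nat)%:R / p%:R) = sin (pi * (fp_abs r)%:R / p%:R) :> R.
  rewrite /fp_abs; have [//|_] := leqP r (p - r)%N.
  rewrite natrB 1?ltnW// mulrBr mulrBl mulfK ?gt_eqF// sinB sinpi cospi.
  by rewrite mul0r sub0r mulN1r opprK.
have := fp_abs_le r p_pr; rewrite -(ler_nat R) natrM => a_le.
set a := (fp_abs r)%:R in a_le *; have a_ge0 : 0 <= a by rewrite ler0n.
have pi0 := pi_gt0 R.
apply: le_trans (ler_norm _).
have -> : a / p%:R = (pi * a / p%:R) / pi.
  by rewrite mulrC -[pi * a / _]mulrA [RHS]mulrC mulKf ?gt_eqF// mulrC.
apply: sin_ge_linear; apply/andP; split.
  by rewrite divr_ge0 ?mulr_ge0 ?(ltW pi0) ?(ltW p_gt0).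
by rewrite ler_pdivrMr//; nra.
Qed.

(** Multiplied by [1 - w] the sum telescopes to [w^a - w^b]. The product form also covers
    [w = 1]. *)
Lemma norm_geometric_sum w a b : `|w| = 1 ->
  `|\sum_(a <= v < b) w ^+ v| * `|1 - w| <= 2.
Proof.
move=> w1; have [ba|/ltnW ab] := leqP b a.
  by rewrite big_geq// normr0 mul0r.
rewrite -normrM mulr_suml.
rewrite (@telescope_sumr_eq _ _ _ (fun v => - w ^+ v) _ ab); last first.
  by move=> k _; rewrite mulrBr mulr1 -exprSr opprK addrC.
apply: le_trans (ler_normB _ _) _.
by rewrite !normrN !normrX w1 !expr1n.
Qed.

End ExponentialSums.

(** * Slices of a convex set and the inner sum *)

Lemma convex_pred_interval (P : pred nat) V :
  (forall i j k, (i <= j <= k)%N -> P i -> P k -> P j) ->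
  exists a b, forall v, (1 <= v < V.+1)%N && P v = (a <= v < b)%N.
Proof.
move=> P_convex; pose Q v := (1 <= v < V.+1)%N && P v.
have [[v0 Qv0]|noQ] := pselect (exists v, Q v); last first.
  exists 0%N, 0%N => v; rewrite ltn0 andbF; apply/negbTE/negP => Qv.
  by apply: noQ; exists v.
have exQ : exists v, Q v by exists v0.
have Q_le v : Q v -> (v <= V)%N by case/andP => /andP[].
case: (ex_minnP exQ) => a Qa a_min; case: (ex_maxnP exQ Q_le) => b Qb b_max.
exists a, b.+1 => v; apply/idP/idP => [Qv|/andP[av vb]].
  by rewrite a_min// ltnS b_max.
move: Qa Qb => /andP[/andP[a1 _] Pa] /andP[/andP[_ bV] Pb].
rewrite (leq_trans a1 av) (leq_ltn_trans _ bV)//=.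
by apply: P_convex Pa Pb; rewrite av.
Qed.

Lemma convex_set_slice (R : realType) (C : set (R^o * R^o)) (u : R) (i j k : nat) :
  convex_set C -> (i <= j <= k)%N ->
  C (u, i%:R) -> C (u, k%:R) -> C (u, j%:R).
Proof.
move=> cC /andP[ij jk] Ci Ck.
have [ik|lt_ik] := leqP k i; first by rewrite (_ : j = i)//; lia.
have ik_gt0 : 0 < k%:R - i%:R :> R by rewrite subr_gt0 ltr_nat.
have jk' : j%:R <= k%:R :> R by rewrite ler_nat.
have ij' : i%:R <= j%:R :> R by rewrite ler_nat.
(* The quotient is the weight [t] solving [t i + (1 - t) k = j]. *)
have t_ge0 : 0 <= (k%:R - j%:R) / (k%:R - i%:R) :> R.
  by apply: divr_ge0; [rewrite subr_ge0|exact: ltW].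
have t_le1 : (k%:R - j%:R) / (k%:R - i%:R) <= 1 :> R.
  by rewrite ler_pdivrMr// mul1r lerD2l lerN2.
have := cC (u, i%:R) (u, k%:R) (Itv01 t_ge0 t_le1) (mem_set Ci) (mem_set Ck).
rewrite inE; set z := (z in C z) => Cz; suff <- : z = (u, j%:R) by [].
rewrite [z]surjective_pairing; congr (_, _); rewrite /= /GRing.scale/= /unstable.onem.
  by rewrite -mulrDl addrC subrK mul1r.
by field; rewrite gt_eqF.
Qed.

Section InnerSum.
Variables (R : realType) (p V : nat) (f : {poly 'F_p}) (u : nat).
Variable C : set (R^o * R^o).
Hypotheses (p_pr : prime p) (convC : convex_set C).

Let r : 'F_p := (f.[u%:R])^-1.
Let inner : R[i] :=
  \sum_(1 <= v < V.+1 | `[< C (u%:R, v%:R) >] && (f.[u%:R] != 0))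
    e_mod p (rat_residue f u v)%:R.

Lemma e_mod_rat_residue v :
  e_mod p (rat_residue f u v)%:R = e_mod p (r : nat)%:R ^+ v :> R[i].
Proof.
have -> : rat_residue f u v = ((v * r) %% p)%N.
  by rewrite -(val_Fp_nat p_pr) natrM (natr_Zp r).
by rewrite e_mod_modn ?prime_gt0// natrM e_mod_natM.
Qed.

Lemma norm_inner_sum_le : `|inner| <= V%:R.
Proof.
apply: le_trans (ler_norm_sum _ _ _) _.
under eq_bigr do rewrite norm_e_mod.
rewrite big_const_seq iter_addr_0 ler_nat.
by rewrite (leq_trans (count_size _ _))// size_iota subSS subn0.
Qed.

(** The slice of [C] is an interval of integers, so the sum is geometric of ratio [w = e_p(r)], and
    [|1 - w| >= 2 |r| / p]. If [f(u) = 0] the sum is empty. *)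
Lemma norm_inner_sum_mul_le : `|inner| * (fp_abs r)%:R <= p%:R.
Proof.
rewrite /inner; have [f0|fn0] := eqVneq f.[u%:R] 0.
  by rewrite big_pred0 ?normr0 ?mul0r ?ler0n// => v; rewrite andbF.
have [a [b ab]] := @convex_pred_interval
  (fun v => `[< C (u%:R, v%:R) >]) V (fun i j k ijk Ci Ck =>
    asboolT (convex_set_slice convC ijk (asboolW Ci) (asboolW Ck))).
set w := e_mod p (r : nat)%:R : R[i].
have -> : \sum_(1 <= v < V.+1 | `[< C (u%:R, v%:R) >] && true)
    e_mod p (rat_residue f u v)%:R = \sum_(a <= v < b) w ^+ v :> R[i].
  (* Both ranges are widened to [[0, max(V + 1, b))], which leaves only the predicates to
     compare. *)
  rewrite (big_nat_widen 1 _ (maxn V.+1 b)) ?leq_maxl// (big_nat_widenl 1 0)//.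
  rewrite (big_nat_widen a _ (maxn V.+1 b)) ?leq_maxr// (big_nat_widenl a 0)//.
  apply: eq_big => [v|v _]; last exact: e_mod_rat_residue.
  by rewrite /= andbT [RHS]andbC -ab [RHS]andbC -andbA [(v < _)%N && _]andbC.
have p_gt0 : 0 < p%:R :> R by rewrite ltr0n prime_gt0.
have w1 : `|w| = 1 by exact: norm_e_mod.
have := norm_geometric_sum a b w1; have := norm_1Be_mod_ge R r p_pr.
rewrite -/w; move: (\sum_(_ <= _ < _) _) => S w_ge S_le.
have : `|S| * (2 * (fp_abs r)%:R / p%:R)%:C <= 2.
  by apply: (le_trans _ S_le); rewrite ler_wpM2l.
rewrite !(rmorphM, fmorphV, rmorph_nat)/= => h.
rewrite -(ler_pM2l (ltr0Sn _ 1)) -ler_pdivrMr ?ltr0n ?prime_gt0//.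
by rewrite mulrCA -mulrA.
Qed.

End InnerSum.

(** * Choice of [H] and the factor [p^o(1)] *)

(* When no positive [H] satisfies the strict inequality, [H = 1] still does the
   job: the trivial count of one [u]-fibre per [z] is then good enough. *)
Lemma box_size p d U : (0 < p)%N -> (0 < U)%N ->
  exists H, [/\ (0 < H)%N, (p <= (2 * H) ^ d.+1 * U ^ (\sum_(i < d.+1) i))%N &
    H = 1%N \/ (H ^ d.+1 * U ^ (\sum_(i < d.+1) i) < p)%N].
Proof.
move=> p_gt0 U_gt0; set W := (U ^ _)%N.
have W_gt0 : (0 < W)%N by rewrite expn_gt0 U_gt0.
have [pW|Wp] := leqP p W.
  exists 1%N; split; [by []| |by left].
  by apply: leq_trans pW _; rewrite leq_pmull// expn_gt0.
pose Q H := (H ^ d.+1 * W < p)%N.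
have exQ : exists H, Q H by exists 1%N; rewrite /Q exp1n mul1n.
have Q_le H : Q H -> (H <= p)%N.
  move=> /ltnW; apply: leq_trans.
  case: H => // H; rewrite expnS -mulnA leq_pmulr//.
  by rewrite muln_gt0 W_gt0 expn_gt0.
case: (ex_maxnP exQ Q_le) => H QH H_max.
have H_gt0 : (0 < H)%N by apply: H_max; rewrite /Q exp1n mul1n.
exists H; split; [by []| |by right].
have : ~~ Q H.+1 by apply/negP => /H_max; rewrite ltnn.
rewrite /Q -leqNgt => /leq_trans; apply.
by rewrite leq_mul2r leq_exp2r// mul2n -addnn -addn1 leq_add2l H_gt0 orbT.
Qed.

(** There are [2 Z] signed residues of absolute value between 1 and [Z], each attained for at most
    [d] values of [u]. *)
Lemma count_small_inverse_trivial p d U Z (f : {poly 'F_p}) :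
  prime p -> (0 < d)%N -> (U < p)%N -> size f = d.+1 ->
  (count (fun u => (f.[u%:R] != 0%R) && (fp_abs (f.[u%:R])^-1 <= Z))
     (index_iota 1 U.+1) <= Z * (2 * d))%N.
Proof.
move=> p_pr d_gt0 Up size_f.
pose E (m : nat) (s : bool) (u : nat) :=
  f.[u%:R] == (((-1) ^+ s * m%:Z)%:~R)^-1.
pose Q (m u : nat) := has ((E m)^~ u) [:: false; true].
rewrite -[Z in (_ <= Z * _)%N](size_iota 1 Z).
apply: (@count_le_cover _ _ _ _ _ Q) => [u _ /andP[fu_neq0 z_le]|m _].
  apply/hasP; exists (fp_abs (f.[u%:R])^-1).
    by rewrite mem_iota add1n ltnS z_le fp_abs_gt0// invr_eq0.
  have [s def_z] := fp_absP (f.[u%:R])^-1 p_pr.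
  by apply/hasP; exists s; [case: s {def_z}|rewrite /E def_z invrK].
apply: (@count_le_cover _ _ _ _ [:: false; true] (E m)) => [u _ //|s _].
exact: count_poly_fiber.
Qed.

(* The range covers every [t + k p] met in [count_small_inverse], as well as the
   power of 2 used to bound the number of dyadic ranges. *)
Definition max_divisors d p : nat :=
  \max_(n < ((2 * d + 3) * p ^ 2).+1) size (divisors n).

Lemma leq_max_divisors d p n :
  (n <= (2 * d + 3) * p ^ 2)%N -> (size (divisors n) <= max_divisors d p)%N.
Proof.
rewrite -ltnS => n_lt.
exact: (@leq_bigmax _ (fun n : 'I_ _ => size (divisors n)) (Ordinal n_lt)).
Qed.

Lemma max_divisors_gt0 d p : (0 < p)%N -> (0 < max_divisors d p)%N.
Proof.
move=> p_gt0; apply: (@leq_trans (size (divisors 1))) => //.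
by apply: leq_max_divisors; rewrite muln_gt0 expn_gt0 p_gt0 addnS.
Qed.

Lemma max_divisors_bound d k : (0 < k)%N -> exists2 c, (0 < c)%N &
  forall p, (0 < p)%N -> (max_divisors d p ^ k <= c * p ^ 2)%N.
Proof.
move=> k_gt0; have [c c_gt0 c_bnd] := divisor_bound k_gt0.
exists (c * (2 * d + 3))%N; first by rewrite muln_gt0 c_gt0 addnS.
move=> p p_gt0; rewrite -mulnA /max_divisors.
apply: (big_ind (fun m => m ^ k <= _)%N) => [|x y xB yB|n _].
- by rewrite exp0n.
- by rewrite /maxn; case: ifP.
have [->|n_gt0] := posnP n.
  by rewrite exp1n !muln_gt0 c_gt0 p_gt0 addnS.
by apply: leq_trans (c_bnd n n_gt0) _; rewrite leq_mul2l -ltnS ltn_ord orbT.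
Qed.

(** Once [p >= c], the hypothesis gives [D(p)^k <= p^3], so the ratio is at most [3 / k], and [k] is
    chosen larger than [3 / e]. *)
Lemma ln_ratio_cvg0 (R : realType) (D : nat -> nat) :
  (forall p, (0 < p)%N -> (0 < D p)%N) ->
  (forall k, (0 < k)%N -> exists2 c, (0 < c)%N &
     forall p, (0 < p)%N -> (D p ^ k <= c * p ^ 2)%N) ->
  ln (D n)%:R / ln n%:R @[n --> \oo] --> (0 : R).
Proof.
move=> D_gt0 D_bnd; apply/cvgr0Pnorm_le => e e_gt0.
pose k := (Num.bound (3 / e)).
have k_big : 3 / e < k%:R :> R by apply: archi_boundP; rewrite divr_ge0// ltW.
have k_gt0 : (0 < k)%N by rewrite -(ltr_nat R) (le_lt_trans _ k_big)// divr_ge0// ltW.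
have [c c_gt0 c_bnd] := D_bnd k k_gt0.
near=> p; have p_ge2 : (2 <= p)%N by near: p; exact: nbhs_infty_ge.
have cp : (c <= p)%N by near: p; exact: nbhs_infty_ge.
have p_gt0 : (0 < p)%N by apply: ltnW.
have lnp_gt0 : 0 < ln p%:R :> R by rewrite ln_gt0// ltr1n.
have lnD_ge0 : 0 <= ln (D p)%:R :> R by rewrite ln_ge0// ler1n D_gt0.
rewrite ger0_norm ?divr_ge0 ?(ltW lnp_gt0)// ler_pdivrMr//.
have le3 : k%:R * ln (D p)%:R <= 3 * ln p%:R :> R.
  rewrite !mulr_natl -!lnXn ?ltr0n ?D_gt0// ler_ln ?posrE ?exprn_gt0 ?ltr0n ?D_gt0//.
  rewrite -!natrX ler_nat; apply: leq_trans (c_bnd p p_gt0) _.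
  by rewrite [leqRHS]expnS leq_mul2r cp orbT.
rewrite -(ler_pM2l (_ : 0 < k%:R :> R)) ?ltr0n//.
apply: le_trans le3 _; rewrite mulrA ler_wpM2r ?(ltW lnp_gt0)//.
by rewrite -ler_pdivrMr// ltW.
Unshelve. all: by end_near.
Qed.

(** Take [(d+1)]-th roots, using [0 + 1 + ... + d = d (d + 1) / 2], and write
    [p = p^(d/(d+1)) p^(1/(d+1))]. *)
Lemma box_size_powR (R : realType) p d U H :
  (0 < p)%N -> (0 < U)%N -> (0 < H)%N ->
  (p <= (2 * H) ^ d.+1 * U ^ (\sum_(i < d.+1) i))%N ->
  p%:R / H%:R <= 2 * (p%:R `^ (d%:R / d.+1%:R) * U%:R `^ (d%:R / 2)) :> R.
Proof.
move=> p_gt0 U_gt0 H_gt0 p_le.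
have d1_neq0 : d.+1%:R != 0 :> R by rewrite pnatr_eq0.
have sumE : (\sum_(i < d.+1) i)%N%:R = d.+1%:R * (d%:R / 2) :> R.
  have : (2 * (\sum_(i < d.+1) i) = d.+1 * d)%N.
    elim: {p_le d1_neq0} d => [|n IH]; first by rewrite big_ord_recr big_ord0.
    by rewrite big_ord_recr/= mulnDr IH; lia.
  by move/(congr1 (GRing.natmul (1 : R))); rewrite !natrM => h; lra.
have root_le : p%:R `^ (d.+1%:R^-1) <= (2 * H%:R) * U%:R `^ (d%:R / 2) :> R.
  have -> : (2 * H%:R) * U%:R `^ (d%:R / 2)
      = (((2 * H) ^ d.+1 * U ^ (\sum_(i < d.+1) i))%N%:R) `^ (d.+1%:R^-1) :> R.
    rewrite natrM powRM// natrX -powR_mulrn// -powRrM (mulfV d1_neq0) powRr1// natrM.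
    by rewrite natrX -powR_mulrn// -powRrM sumE [_ * _ / d.+1%:R]mulrAC (mulfV d1_neq0) mul1r.
  by rewrite ge0_ler_powR ?nnegrE ?invr_ge0// ler_nat.
have pE : p%:R = p%:R `^ (d%:R / d.+1%:R) * p%:R `^ (d.+1%:R^-1) :> R.
  rewrite -powRD; last by rewrite pnatr_eq0 -lt0n p_gt0 implybT.
  by rewrite -[X in _ + X]mul1r -mulrDl natr1 (mulfV d1_neq0) powRr1.
rewrite ler_pdivrMr ?ltr0n// [leLHS]pE.
apply: le_trans (ler_wpM2l (powR_ge0 _ _) root_le) _.
by rewrite le_eqVlt; apply/orP; left; apply/eqP; ring.
Qed.

Lemma count_small_inverse_box p d H U Z (f : {poly 'F_p}) :
  prime p -> (0 < d)%N -> (0 < H)%N -> (0 < U < p)%N -> size f = d.+1 ->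
  H = 1%N \/ (H ^ d.+1 * U ^ (\sum_(i < d.+1) i) < p)%N -> (Z <= 2 * p)%N ->
  (count (fun u => (f.[u%:R] != 0%R) && (fp_abs (f.[u%:R])^-1 <= Z))
     (index_iota 1 U.+1) * H
   <= 2 * d * max_divisors d p * (3 * H + 2 * d.+1 * Z))%N.
Proof.
move=> p_pr d_gt0 H_gt0 /andP[U_gt0 Up] size_f [H1|H_small] Zp; last first.
  apply: count_small_inverse => //; first by rewrite U_gt0.
  by move=> n _; exact: leq_max_divisors.
have T_gt0 := max_divisors_gt0 d (prime_gt0 p_pr).
rewrite H1 !muln1.
apply: leq_trans (count_small_inverse_trivial Z p_pr d_gt0 Up size_f) _.
rewrite -mulnA mulnC leq_mul2l; apply/orP; right.
by apply: leq_trans (leq_pmull _ T_gt0); nia.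
Qed.

(** * Assembly of the estimate *)

(** One factor [T] comes from counting the [u] in a dyadic range, the other bounds the number of
    ranges. *)
Lemma norm_S_sum_le (R : realType) p d U V (f : {poly 'F_p})
    (alpha : nat -> R[i]) (C : set (R^o * R^o)) (T := max_divisors d p) :
  prime p -> (0 < d)%N -> (0 < U < p)%N -> size f = d.+1 ->
  (forall u, (1 <= u <= U)%N -> `|alpha u| <= 1) -> convex_set C ->
  `|S_sum f U V alpha C| <=
    ((16 * d * d.+1 * T ^ 2)%N%:R
     * (p%:R `^ (d%:R / d.+1%:R) * U%:R `^ (d%:R / 2) + V%:R))%:C.
Proof.
move=> p_pr d_gt0 /andP[U_gt0 Up] size_f alpha_le1 convC.
have p_gt0 := prime_gt0 p_pr.
have [H [H_gt0 p_le H_box]] := box_size d p_gt0 U_gt0.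
have pH_le := box_size_powR R p_gt0 U_gt0 H_gt0 p_le.
pose inner u : R[i] :=
  \sum_(1 <= v < V.+1 | `[< C (u%:R, v%:R) >] && (f.[u%:R] != 0))
    e_mod p (rat_residue f u v)%:R.
(* The norm of [inner u] as an element of [R], since the dyadic summation takes place in an ordered
   field of reals. *)
pose x u : R := Num.sqrt (complex.Re (inner u) ^+ 2 + complex.Im (inner u) ^+ 2).
have xE u : `|inner u| = (x u)%:C by rewrite normc_def.
set N : R := _ * U%:R `^ _ in pH_le *.
have N_ge0 : 0 <= N by rewrite mulr_ge0 ?powR_ge0.
have S_le : `|S_sum f U V alpha C| <=
    (\sum_(u <- index_iota 1 U.+1 | f.[u%:R] != 0%R) x u)%:C.
  rewrite rmorph_sum (eq_bigr (fun u => `|inner u|)); last first.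
    by move=> u _; exact: esym (xE u).
  rewrite [leRHS]big_mkcond; apply: le_trans (ler_norm_sum _ _ _) _.
  rewrite [leLHS]big_seq [leRHS]big_seq; apply: ler_sum => u.
  rewrite mem_index_iota => uU; rewrite -mulr_sumr normrM -/(inner u).
  have [f0|fn0] := boolP (f.[u%:R] != 0); last first.
    rewrite /inner big_pred0 ?normr0 ?mulr0// => v.
    by rewrite (negbTE fn0) andbF.
  by rewrite ler_piMl// alpha_le1.
apply: le_trans S_le _; rewrite lecR.
set L := (trunc_log 2 p).+1.
have pL : (p < 2 ^ L)%N by exact: trunc_log_ltn.
have Lp : (2 ^ L.-1 <= p)%N by exact: trunc_logP.
(* The number [2^(L-1) <= p] has exactly [L] divisors. *)
have L_le : (L <= T)%N.
  rewrite /L -(size_divisors_pfactor (trunc_log 2 p) (isT : prime 2)).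
  apply: leq_max_divisors; apply: leq_trans Lp _; nia.
have T_gt0 : 0 < T%:R :> R by rewrite ltr0n max_divisors_gt0.
(* [A] and [B] come from dividing [2 d T (3 H + 2 (d + 1) 2^(j+1))] by [H]. *)
apply: le_trans (sum_le_dyadic (rho := fun u => fp_abs (f.[u%:R])^-1)
  (V := V%:R) (q := p%:R) (A := (6 * d * T)%N%:R)
  (B := (8 * d * d.+1 * T)%N%:R / H%:R) (L := L) _ _ _ _ _ _) _ => //.
- move=> u _ fu; split.
  + by rewrite -lecR -xE rmorph_nat norm_inner_sum_le.
  + by rewrite -lecR rmorphM/= -xE !rmorph_nat norm_inner_sum_mul_le.
  + rewrite fp_abs_gt0 ?invr_eq0//= (leq_ltn_trans _ pL)//.
    by have := fp_abs_le (f.[u%:R])^-1 p_pr; lia.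
- move=> j jL; have Z_le : (2 ^ j.+1 <= 2 * p)%N.
    by rewrite expnS leq_mul2l (leq_trans _ Lp)// leq_exp2l.
  have := count_small_inverse_box p_pr d_gt0 H_gt0 _ size_f H_box Z_le.
  rewrite U_gt0 Up => /(_ isT); set cnt := count _ _ => cnt_le.
  have H_gt0' : 0 < H%:R :> R by rewrite ltr0n.
  rewrite -(ler_pM2r H_gt0') mulrDl mulrAC divfK ?gt_eqF//.
  rewrite -natrX -!natrM -natrD ler_nat (leq_trans cnt_le)// /T expnS.
  by apply: eq_leq; ring.
rewrite !natrM -/T.
have LT : L%:R <= T%:R :> R by rewrite ler_nat.
have d1 : 1 <= d%:R :> R by rewrite ler1n.
have k1 : 1 <= d.+1%:R :> R by rewrite ler1n.
have q_ge0 : 0 <= p%:R / H%:R :> R by rewrite divr_ge0.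
move: LT pH_le T_gt0 d1 k1 q_ge0.
rewrite -[_ / H%:R * p%:R]mulrA [_^-1 * p%:R]mulrC.
have : 0 <= V%:R :> R by [].
move: (V%:R) (L%:R) (p%:R / H%:R) (T%:R) (d%:R) (d.+1%:R).
move=> v l q t e k v_ge0 lt qN t_gt0 e1 k1 q_ge0.
have et_ge0 : 0 <= e * (t * t) by rewrite !mulr_ge0 ?(ltW t_gt0)//; lra.
have ekt_ge0 : 0 <= e * k * (t * t) by rewrite mulrAC mulr_ge0//; lra.
have sum_ge0 : 0 <= 6 * e * t * v + 8 * e * k * t * q.
  by rewrite addr_ge0 ?mulr_ge0 ?(ltW t_gt0)//; lra.
apply: le_trans (ler_wpM2r sum_ge0 lt) _.
have h1 := ler_wpM2l ekt_ge0 qN.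
have h2 : 6 * v <= 16 * k * v by rewrite ler_wpM2r//; lra.
have h3 := ler_wpM2l et_ge0 h2.
have -> : t * (6 * e * t * v + 8 * e * k * t * q)
    = e * (t * t) * (6 * v) + 8 * (e * k * (t * t) * q) by ring.
have -> : 16 * e * k * (t * t) * (N + v)
    = e * (t * t) * (16 * k * v) + 8 * (e * k * (t * t) * (2 * N)) by ring.
by rewrite lerD// ler_wpM2l.
Qed.

Theorem theorem2p1 (R : realType) (d : nat) (hd : (1 <= d)%N) :
  exists eps1 eps2 : nat -> R,
    [/\ eps1 n @[n --> \oo] --> (0 : R), eps2 n @[n --> \oo] --> (0 : R) &
    forall (p U V : nat) (f : {poly 'F_p}) (alpha : nat -> R[i])
           (C : set (R^o * R^o)),
      prime p ->
      (1 <= U < p)%N -> (1 <= V < p)%N ->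
      size f = d.+1 ->
      (forall u, (1 <= u <= U)%N -> `|alpha u| <= 1) ->
      C `<=` `[1, U%:R]%classic `*` `[1, V%:R]%classic ->
      convex_set C ->
      `|S_sum f U V alpha C| <=
        (p%:R `^ (d%:R / d.+1%:R + eps1 p) * U%:R `^ (d%:R / 2)
         + V%:R * p%:R `^ (eps2 p))%:C].
Proof.
pose D p := (16 * d * d.+1 * max_divisors d p ^ 2)%N.
have D_gt0 p : (0 < p)%N -> (0 < D p)%N.
  by move=> p_gt0; rewrite !muln_gt0 hd max_divisors_gt0.
(* Chosen so that [p^(eps p)] equals [D p]; the same exponent serves both terms. *)
pose eps p : R := ln (D p)%:R / ln p%:R.
have eps0 : eps n @[n --> \oo] --> (0 : R).
  apply: ln_ratio_cvg0 => // k k_gt0.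
  (* The power is [2 k] because [D] contains the square of [max_divisors]. *)
  have [|c c_gt0 c_bnd] := @max_divisors_bound d (2 * k); first by rewrite muln_gt0.
  exists ((16 * d * d.+1) ^ k * c)%N.
    by rewrite muln_gt0 expn_gt0 !muln_gt0 hd.
  by move=> p p_gt0; rewrite /D [leqLHS]expnMn -[leqRHS]mulnA leq_mul2l -expnM c_bnd// orbT.
exists eps, eps; split => // p U V f alpha C p_pr U_lt _ size_f alpha_le1 _ convC.
have p_gt1 := prime_gt1 p_pr; have p_gt0 := prime_gt0 p_pr.
have pn0 : p%:R != 0 :> R by rewrite pnatr_eq0 -lt0n.
have lnp_gt0 : 0 < ln p%:R :> R by rewrite ln_gt0// ltr1n.
have p_eps : p%:R `^ eps p = (D p)%:R :> R.
  by rewrite /powR (negbTE pn0) /eps divfK ?gt_eqF// lnK// posrE ltr0n D_gt0.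
apply: le_trans (norm_S_sum_le V p_pr hd U_lt size_f alpha_le1 convC) _.
rewrite lecR powRD ?pn0 ?implybT// p_eps -/(D p).
by rewrite le_eqVlt; apply/orP; left; apply/eqP; ring.
Qed.
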